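(* Suppose $E:\mathcal{P}_{2,\omega_0}(\mathbb{R}^d)\to\mathbb{R}\cup\{+\infty\}$ is proper, coercive, lower semicontinuous and $\lambda$-convex along generalized geodesics for some $\lambda\in\mathbb{R}$. Let $\mu\in D(|\partial E|)$ and $0<h_i\le\tau<\frac1{\lambda^-}$ for $i\ge1$. Writing $J^m=J_{h_m}\circ\cdots\circ J_{h_1}\mu$ ($J^0=\mu$), $J^n=J^n_\tau\mu$, $S_m=\sum_{k=1}^mh_k$, $P_m=\prod_{k=1}^m(1-\lambda^-h_k)^{-1}$, we have for all $n,m\ge0$ $$W_2^2(J^n,J^m)\le\big[(n\tau-S_m)^2+\tau S_m+2\tau^2n\big](1-\lambda^-\tau)^{-2n}P_m^2|\partial E|^2(\mu).$$
   Context: Fix a probability measure $\omega_0$ on $\mathbb{R}^d$. $W_2$ is the quadratic Wasserstein distance, $\Gamma_0$ the optimal couplings; $\mathcal{P}_{2,\omega_0}(\mathbb{R}^d)=\{\mu:W_2(\mu,\omega_0)<\infty\}$. A transport plan from $\mu_0$ to $\mu_1$ with base $\omega$ is $\boldsymbol\omega\in\mathcal{P}((\mathbb{R}^d)^3)$ with $\pi^{1,2}\#\boldsymbol\omega\in\Gamma_0(\omega,\mu_0)$, $\pi^{1,3}\#\boldsymbol\omega\in\Gamma_0(\omega,\mu_1)$; generalized geodesic $\mu_\alpha=((1-\alpha)\pi^2+\alpha\pi^3)\#\boldsymbol\omega$; $W_{2,\boldsymbol\omega}(\mu_0,\mu_1)=(\int|x_2-x_3|^2d\boldsymbol\omega)^{1/2}$.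 $D(E)=\{E<\infty\}$; proper: $D(E)\ne\emptyset$; coercive: $\exists\tau_0>0,u_0$ with $\inf_v\{\frac1{2\tau_0}W_2^2(u_0,v)+E(v)\}>-\infty$; lower semicontinuous w.r.t. $W_2$; $\lambda$-convex along generalized geodesics: for all $\mu_0,\mu_1,\omega$ there is a generalized geodesic from $\mu_0$ to $\mu_1$ with base $\omega$ (induced by some $\boldsymbol\omega$) with $E(\mu_\alpha)\le(1-\alpha)E(\mu_0)+\alpha E(\mu_1)-\alpha(1-\alpha)\frac\lambda2W^2_{2,\boldsymbol\omega}(\mu_0,\mu_1)$. $\lambda^-=\max\{0,-\lambda\}$, $1/\lambda^-=+\infty$ if $\lambda^-=0$. $J_\tau\mu=\operatorname{argmin}_\nu\{\frac1{2\tau}W_2^2(\mu,\nu)+E(\nu)\}$, $J^n_\tau$ its $n$-fold iterate. Metric slope $|\partial E|(\mu)=\limsup_{\nu\to\mu}(E(\mu)-E(\nu))^+/W_2(\mu,\nu)$; $D(|\partial E|)=\{\mu\in D(E):|\partial E|(\mu)<\infty\}$. *)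

(* Defs.v *)
From HB Require Import structures.
From mathcomp Require Import all_boot all_order all_algebra.
From mathcomp Require Import all_classical all_reals all_analysis.
Set Implicit Arguments.
Unset Strict Implicit.
Unset Printing Implicit Defensive.
Import Order.TTheory GRing.Theory Num.Theory.
Import numFieldNormedType.Exports.
Local Open Scope classical_set_scope.
Local Open Scope ring_scope.

(* R^d = row vectors 'rV[R]_d with the Borel sigma-algebra (generated by the
   open sets of the usual (product = Euclidean) topology). *)
Definition Rd (R : realType) (d : nat) : measurableType (sigma_display (@open 'rV[R]_d)) :=
  g_sigma_algebraType (@open 'rV[R]_d).

Definition sqdist (R : realType) (d : nat) (x y : Rd R d) : R :=
  \sum_(i < d) (x ord0 i - y ord0 i) ^+ 2.

Section W2.
Context (R : realType) (d : nat).
Local Notation T := (Rd R d).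
Local Open Scope ereal_scope.

Definition coupling (mu nu : probability T R) (g : probability (T * T)%type R) :=
  forall A : set T, measurable A ->
    g (fst @^-1` A) = mu A /\ g (snd @^-1` A) = nu A.

Definition cost (g : probability (T * T)%type R) : \bar R :=
  \int[g]_z (sqdist z.1 z.2)%:E.

Definition W2sq (mu nu : probability T R) : \bar R :=
  ereal_inf [set c | exists g, coupling mu nu g /\ c = cost g].

(* W_2 as a real number (meaningful when W2sq is finite) *)
Definition W2 (mu nu : probability T R) : R := Num.sqrt (fine (W2sq mu nu)).

Definition Gamma0 (mu nu : probability T R) (g : probability (T * T)%type R) :=
  coupling mu nu g /\ cost g = W2sq mu nu.

Definition P2 (omega0 mu : probability T R) := W2sq mu omega0 < +oo.

Definition transport_plan (om mu0 mu1 : probability T R)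
  (w : probability ((T * T) * T)%type R) :=
  (exists g, Gamma0 om mu0 g /\ forall B : set (T * T), measurable B ->
      g B = w ((fun z : (T * T) * T => (z.1.1, z.1.2)) @^-1` B)) /\
  (exists g, Gamma0 om mu1 g /\ forall B : set (T * T), measurable B ->
      g B = w ((fun z : (T * T) * T => (z.1.1, z.2)) @^-1` B)).

Definition W2plan_sq (w : probability ((T * T) * T)%type R) : \bar R :=
  \int[w]_z (sqdist z.1.2 z.2)%:E.

Definition is_gen_geod_point (w : probability ((T * T) * T)%type R) (a : R)
  (mua : probability T R) :=
  forall A : set T, measurable A ->
    mua A = w ((fun z : (T * T) * T =>
       ((1 - a) *: (z.1.2 : 'rV[R]_d) + a *: (z.2 : 'rV[R]_d))%R : T) @^-1` A).

Section Functional.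
Variables (omega0 : probability T R) (E : probability T R -> \bar R).

Definition proper_fun := exists mu, P2 omega0 mu /\ E mu < +oo.

Definition coercive :=
  exists tau0 : R, (0 < tau0)%R /\ exists u0, P2 omega0 u0 /\
    -oo < ereal_inf [set ((2 * tau0)^-1)%:E * W2sq u0 v + E v | v in P2 omega0].

Definition lsc_W2 :=
  forall mu, P2 omega0 mu -> forall t : R, t%:E < E mu ->
    exists r : R, (0 < r)%R /\
      forall nu, P2 omega0 nu -> (W2 mu nu < r)%R -> t%:E < E nu.

Definition convex_gen_geod (lam : R) :=
  forall mu0 mu1 om, P2 omega0 mu0 -> P2 omega0 mu1 -> P2 omega0 om ->
    exists w, transport_plan om mu0 mu1 w /\
      forall a : R, (0 <= a <= 1)%R -> exists mua, is_gen_geod_point w a mua /\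
        E mua <= (1 - a)%:E * E mu0 + a%:E * E mu1
                 - (a * (1 - a) * lam / 2)%:E * W2plan_sq w.

Definition is_JKO_step (tau : R) (mu nu : probability T R) :=
  P2 omega0 nu /\ forall v, P2 omega0 v ->
    ((2 * tau)^-1)%:E * W2sq mu nu + E nu <= ((2 * tau)^-1)%:E * W2sq mu v + E v.

Definition slope (mu : probability T R) : \bar R :=
  ereal_inf [set ereal_sup [set maxe (E mu - E nu) 0 * ((W2 mu nu)^-1)%:E
                           | nu in [set nu | P2 omega0 nu /\
                                     (0 < W2 mu nu)%R /\ (W2 mu nu < r)%R]]
            | r in [set r : R | (0 < r)%R]].

Definition in_dom_slope (mu : probability T R) :=
  P2 omega0 mu /\ E mu < +oo /\ slope mu < +oo.

End Functional.
End W2.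

Definition lam_minus (R : realType) (lam : R) : R := Num.max 0 (- lam).

(* Main.v *)
Require Import Defs.
From HB Require Import structures.
From mathcomp Require Import all_boot all_order all_algebra.
From mathcomp Require Import all_classical all_reals all_analysis.
From mathcomp Require Import measurable_realfun ring lra.
Import Order.TTheory GRing.Theory Num.Theory.
Import numFieldNormedType.Exports.
Local Open Scope classical_set_scope.
Local Open Scope ring_scope.

(** Convexity along generalized geodesics with base [mu], applied between
    [J = J_tau mu] and [v], makes [v |-> W2^2(mu, v) / (2 tau) + E v] uniformly
    convex along the geodesic; minimality of [J] then gives the discrete
    evolution variational inequality
      [(1 - l tau) W2^2(J, v) - W2^2(mu, v)
        <= 2 tau (E v - E J) - W2^2(mu, J)],   [l = lambda^-].
    Writing it for [Jt n.+1] with [v := Jh m.+1] and for [Jh m.+1] with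
    [v := Jt n.+1], and cancelling the energies, yields for
    [a n m = W2^2(Jt n, Jh m)] and [h = h_{m+1}]
      [(tau (1 - l h) + h (1 - l tau)) a (n+1) (m+1)
        <= tau a (n+1) m + h a n (m+1)],
    of which the claimed bound is a supersolution.  On the axes [n = 0] and
    [m = 0] the bound comes from the triangle inequality and the fact that the
    slope grows by at most [1 / (1 - l h)] per step.

    The triangle inequality itself is read off the plans that the convexity
    hypothesis provides, so the general gluing lemma is not needed.  What is
    needed is that generalized geodesics stay at finite distance from [omega0];
    this only takes a crude gluing, independent inside each unit cube. *)

(** * Measurability *)

Section Measurability.
Context {R : realType} {d : nat}.
Local Notation T := (Rd R d).

Lemma measurable_coord (i : 'I_d) :
  measurable_fun [set: T] (fun x : T => x ord0 i).
Proof.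
apply: (measurability _ (RGenOInfty.measurableE R)).
move=> _ [_ [a ->] <-]; rewrite setTI.
apply: sub_sigma_algebra.
apply: open_comp; last exact: interval_open.
by move=> x _; apply: coord_continuous.
Qed.

(** Rational balls form a countable base, and a sup-norm ball is a finite intersection of coordinate
    conditions, so measurability into [Rd] reduces to coordinates. *)
Lemma open_ratball (U : set 'rV[R]_d) : open U ->
  U = \bigcup_(k : 'rV[rat]_d * rat)
    [set x : 'rV[R]_d |
       (0 < ratr k.2 :> R /\ ball (map_mx ratr k.1 : 'rV[R]_d) (ratr k.2) `<=` U) /\
       forall j, `|x ord0 j - ratr (k.1 ord0 j)| < ratr k.2].
Proof.
move=> oU; apply/seteqP; split => x; last first.
  move=> [[q r] _] /= [[r0 qU] xq]; apply: qU; split => // i j.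
  by rewrite !ord1 mxE /ball /= distrC; exact: xq.
move=> Ux.
have /nbhs_ballP[e /= e0 eU] : nbhs x U by exact: open_nbhs_nbhs.
(* With radius below [e / 2], a ball whose centre is within [r] of [x] stays within [e] of [x]. *)
have [r] : exists r : rat, ratr r \in `]0, (e / 2)[ .
  by apply: rat_in_itvoo; rewrite divr_gt0.
rewrite in_itv /= => /andP[r0 re].
have /choice[q qP] j : exists q : rat, `|x ord0 j - ratr q| < ratr r.
  have [q] : exists q : rat,
      ratr q \in `](x ord0 j - ratr r), (x ord0 j + ratr r)[.
    by apply: rat_in_itvoo; lra.
  by rewrite in_itv /= => q1; exists q; rewrite ltr_norml; lra.
exists (\row_j q j, r) => //=; split; last by move=> j; rewrite mxE.
split=> // y -[_ Hy]; apply: eU; split => // i j.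
have := Hy i j; have := qP j; rewrite !ord1 !mxE /ball /= => H1 H2.
rewrite (_ : x ord0 j - y ord0 j =
  (x ord0 j - ratr (q j)) + (ratr (q j) - y ord0 j)); last ring.
apply: le_lt_trans (ler_normD _ _) _; lra.
Qed.

Lemma measurable_fun_Rd {dX} {X : measurableType dX} (f : X -> T) :
  (forall i, measurable_fun setT (fun x => f x ord0 i)) ->
  measurable_fun [set: X] f.
Proof.
move=> mf; apply: (@measurability _ _ X T setT f (@open 'rV[R]_d : set (set T))) => //.
move=> _ [U oU <-]; rewrite setTI (open_ratball U oU) preimage_bigcup.
apply: countable_bigcupT_measurable; first exact: countableP.
move=> [q r] /=.
have [qU|nqU] := pselect (0 < ratr r :> R /\ ball (map_mx ratr q : 'rV[R]_d) (ratr r) `<=` U); last first.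
  rewrite (_ : _ @^-1` _ = set0)//; apply/seteqP; split => // x [] //.
rewrite (_ : _ @^-1` _ = \bigcap_(j in [set: 'I_d])
   ((fun x => f x ord0 j) @^-1` (ball (ratr (q ord0 j) : R) (ratr r)))).
  apply: fin_bigcap_measurable => // j _.
  rewrite -[X in measurable X]setTI; apply: mf => //.
  exact: measurable_ball.
apply/seteqP; split => x /=.
  by move=> [_ H] j _; rewrite /= /ball /= distrC.
by move=> H; split => // j; rewrite distrC; exact: H.
Qed.

End Measurability.

(** * Squared distances, couplings and transport cost *)

Section Sqdist.
Context {R : realType} {d : nat}.
Local Notation T := (Rd R d).

Lemma sqdist_ge0 (x y : T) : 0 <= sqdist x y.
Proof. by apply: sumr_ge0 => i _; exact: sqr_ge0. Qed.

Lemma sqdistC (x y : T) : sqdist x y = sqdist y x.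
Proof. by apply: eq_bigr => i _; rewrite -sqrrN opprB. Qed.

Lemma sqdistxx (x : T) : sqdist x x = 0.
Proof. by rewrite /sqdist big1// => i _; rewrite subrr expr0n. Qed.

Lemma measurable_sqdist {dX} {X : measurableType dX} (f g : X -> T) :
  measurable_fun [set: X] f -> measurable_fun [set: X] g ->
  measurable_fun setT (fun x => (sqdist (f x) (g x))%:E).
Proof.
move=> mf mg; apply/measurable_EFinP; apply: measurable_sum => i.
apply: measurable_funX; apply: measurable_funB.
- exact: (measurableT_comp (measurable_coord i) mf).
- exact: (measurableT_comp (measurable_coord i) mg).
Qed.

(** Lets costs be compared on the space of any plan, whatever its number of legs. *)
Definition msqd {dX} {X : measurableType dX} (w : probability X R)
  (f g : X -> T) : \bar R := (\int[w]_x (sqdist (f x) (g x))%:E)%E.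

Lemma coupling_of_maps {dX} {X : measurableType dX} (w : probability X R)
    (f g : X -> T) (mu nu : probability T R) :
  measurable_fun [set: X] f -> measurable_fun [set: X] g ->
  (forall A, measurable A -> mu A = w (f @^-1` A)) ->
  (forall A, measurable A -> nu A = w (g @^-1` A)) ->
  exists g0, coupling mu nu g0 /\ cost g0 = msqd w f g.
Proof.
move=> mf mg muE nuE.
have mfg : measurable_fun [set: X] (fun x => (f x, g x)).
  exact: measurable_fun_pair.
pose F : {mfun X >-> (T * T)%type} := HB.pack (fun x => (f x, g x)) (isMeasurableFun.Build _ _ _ _ _ mfg).
exists (distribution w F); split.
  by move=> A mA; split; rewrite /distribution /pushforward /= ?muE ?nuE.
rewrite /cost ge0_integral_pushforward//=.
  by apply: measurable_sqdist; [exact: measurable_fst|exact: measurable_snd].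
by move=> y _; rewrite lee_fin sqdist_ge0.
Qed.

Lemma W2sq_le {dX} {X : measurableType dX} (w : probability X R)
    (f g : X -> T) (mu nu : probability T R) :
  measurable_fun [set: X] f -> measurable_fun [set: X] g ->
  (forall A, measurable A -> mu A = w (f @^-1` A)) ->
  (forall A, measurable A -> nu A = w (g @^-1` A)) ->
  (W2sq mu nu <= msqd w f g)%E.
Proof.
move=> mf mg muE nuE; have [g0 [cg cE]] := coupling_of_maps w f g mu nu mf mg muE nuE.
by apply: ereal_inf_lbound; exists g0; rewrite cE.
Qed.

Lemma W2sq_ge0 (mu nu : probability T R) : (0 <= W2sq mu nu)%E.
Proof.
apply: le_ereal_inf_tmp => _ [g [_ ->]].
by apply: integral_ge0 => x _; rewrite lee_fin sqdist_ge0.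
Qed.

Lemma W2sqxx (mu : probability T R) : W2sq mu mu = 0%E.
Proof.
apply/eqP; rewrite eq_le W2sq_ge0 andbT.
apply: le_trans (W2sq_le mu id id mu mu _ _ _ _) _ => //.
by rewrite /msqd integral0_eq// => x _; rewrite sqdistxx.
Qed.

Lemma W2sqC_le (mu nu : probability T R) : (W2sq nu mu <= W2sq mu nu)%E.
Proof.
apply: le_ereal_inf_tmp => _ [g [cg ->]].
apply: le_trans (W2sq_le g snd fst nu mu _ _ _ _) _.
- exact: measurable_snd.
- exact: measurable_fst.
- by move=> A /cg[].
- by move=> A /cg[].
rewrite le_eqVlt; apply/orP; left; apply/eqP.
by apply: eq_integral => x _; rewrite sqdistC.
Qed.

Lemma W2sqC (mu nu : probability T R) : W2sq mu nu = W2sq nu mu.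
Proof. by apply/eqP; rewrite eq_le !W2sqC_le. Qed.

Lemma cost_marginal {dX} {X : measurableType dX} (w : probability X R)
    (f g : X -> T) (g0 : probability (T * T)%type R) :
  measurable_fun [set: X] f -> measurable_fun [set: X] g ->
  (forall B, measurable B -> g0 B = w ((fun x => (f x, g x)) @^-1` B)) ->
  cost g0 = msqd w f g.
Proof.
move=> mf mg gE.
have mfg : measurable_fun [set: X] (fun x => (f x, g x)).
  exact: measurable_fun_pair.
rewrite /cost (@eq_measure_integral _ _ _ _ (pushforward w (fun x => (f x, g x)))).
  rewrite ge0_integral_pushforward//=.
    by apply: measurable_sqdist; [exact: measurable_fst|exact: measurable_snd].
  by move=> y _; rewrite lee_fin sqdist_ge0.
by move=> A mA _; exact: gE.
Qed.

End Sqdist.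

(** * Gluing along a countable partition *)

Section Gluing.
Context {R : realType} {d1 d2} {X1 : measurableType d1} {X2 : measurableType d2}.
Variables (P1 : probability X1 R) (P2 : probability X2 R).
Variables (A : nat -> set X1) (B : nat -> set X2).
Hypotheses (mA : forall k, measurable (A k)) (mB : forall k, measurable (B k)).
Hypotheses (tA : trivIset setT A) (tB : trivIset setT B).
Hypotheses (UA : \bigcup_k A k = setT) (UB : \bigcup_k B k = setT).
Hypothesis AB : forall k, P1 (A k) = P2 (B k).
Local Open Scope ereal_scope.

Let mAB k : measurable (A k `*` B k).
Proof. exact: measurableX. Qed.

Let c_ge0 k : (0 <= (fine (P1 (A k)))^-1)%R.
Proof. by rewrite invr_ge0 fine_ge0. Qed.

(** Each block carries the product measure divided by the common mass of [A k] and [B k], which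
    restores both marginals. On a null block the coefficient is [0^-1 = 0]. *)
Local Notation G := (mseries (fun k => mscale (NngNum (c_ge0 k))
  (mrestr (P1 \x P2)%E (mAB k))) 0).

Let GE (C : set X1) (D : set X2) : measurable C -> measurable D ->
  G (C `*` D) = \sum_(0 <= k <oo)
    (fine (P1 (A k)))^-1%:E * (P1 (C `&` A k) * P2 (D `&` B k)).
Proof.
move=> mC mD; rewrite /mseries; apply: eq_eseriesr => k _.
transitivity ((fine (P1 (A k)))^-1%:E *
  (P1 \x P2)%E ((C `*` D) `&` (A k `*` B k))); first by [].
by rewrite -setXI product_measure1E//; exact: measurableI.
Qed.

Let cancel_mass (x : \bar R) k : 0 <= x -> x <= P1 (A k) ->
  (fine (P1 (A k)))^-1%:E * (x * P1 (A k)) = x.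
Proof.
move=> x0 xA; have fA : P1 (A k) \is a fin_num by exact: fin_num_measure.
have fx : x \is a fin_num.
  by rewrite ge0_fin_numE// (le_lt_trans xA)// ltey_eq fA.
rewrite -(fineK fx) -(fineK fA) -!EFinM; congr EFin.
(* On a null block the inverse is 0, but there [x <= P1 (A k)] forces [x = 0]. *)
have [A0|A0] := eqVneq (fine (P1 (A k))) 0%R; last by rewrite [RHS]/=; field.
rewrite A0 !mulr0; apply/esym/eqP; rewrite eq_le fine_ge0// andbT.
by move: xA; rewrite -(fineK fx) -(fineK fA) A0 lee_fin.
Qed.

Let G1 (C : set X1) : measurable C -> G (C `*` setT) = P1 C.
Proof.
move=> mC; rewrite GE//.
rewrite -[in RHS](setIT C) -UA setI_bigcupr measure_semi_bigcup//.
- apply: eq_eseriesr => k _; rewrite setTI -AB cancel_mass//.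
  by apply: le_measure; rewrite ?inE//; exact: measurableI.
- by move=> k; exact: measurableI.
- exact: trivIset_setIl.
- by rewrite -setI_bigcupr UA setIT.
Qed.

Let G2 (D : set X2) : measurable D -> G (setT `*` D) = P2 D.
Proof.
move=> mD; rewrite GE//.
rewrite -[in RHS](setIT D) -UB setI_bigcupr measure_semi_bigcup//.
- apply: eq_eseriesr => k _; rewrite setTI (muleC (P1 _)) cancel_mass// AB.
  by apply: le_measure; rewrite ?inE//; exact: measurableI.
- by move=> k; exact: measurableI.
- exact: trivIset_setIl.
- by rewrite -setI_bigcupr UB setIT.
Qed.

(* [Q] is, conditionally on each [A k `*` B k], the product of [P1] and [P2]. *)
Lemma gluing : exists Q : probability (X1 * X2)%type R,
  [/\ forall C, measurable C -> Q (fst @^-1` C) = P1 C,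
      forall D, measurable D -> Q (snd @^-1` D) = P2 D &
      Q (~` \bigcup_k (A k `*` B k)) = 0].
Proof.
have GT : G setT = 1 by rewrite -setXTT G1// probability_setT.
pose Q : probability (X1 * X2)%type R := HB.pack G (Measure_isProbability.Build _ _ _ G GT).
exists Q; split.
- by move=> C mC; rewrite -G1// -[RHS]/(Q _); congr (Q _); apply/seteqP; split => // -[x y] [].
- by move=> C mC; rewrite -G2// -[RHS]/(Q _); congr (Q _); apply/seteqP; split => // -[x y] [].
- transitivity (G (~` \bigcup_k (A k `*` B k))); first by [].
  rewrite /mseries eseries0// => k _ _.
  transitivity ((fine (P1 (A k)))^-1%:E *
    (P1 \x P2)%E ((~` \bigcup_k (A k `*` B k)) `&` (A k `*` B k))); first by [].
  rewrite (_ : _ `&` _ = set0) ?measure0 ?mule0//.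
  by apply/seteqP; split => // z [nz kz]; apply: nz; exists k.
Qed.

End Gluing.

(** * Integration of linear inequalities between squared distances *)

Section MeanSquare.
Context {R : realType} {d : nat} {dX : measure_display} {X : measurableType dX}.
Local Notation T := (Rd R d).
Variable w : probability X R.
Implicit Types f g : X -> T.

Lemma integral_sqdist_lin (a b c : R) f1 g1 f2 g2 :
  measurable_fun [set: X] f1 -> measurable_fun [set: X] g1 ->
  measurable_fun [set: X] f2 -> measurable_fun [set: X] g2 ->
  0 <= a -> 0 <= b -> 0 <= c ->
  (\int[w]_x (a * sqdist (f1 x) (g1 x) + b * sqdist (f2 x) (g2 x) + c)%:E
   = a%:E * msqd w f1 g1 + b%:E * msqd w f2 g2 + c%:E)%E.
Proof.
move=> mf1 mg1 mf2 mg2 a0 b0 c0.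
have m1 := measurable_sqdist _ _ mf1 mg1; have m2 := measurable_sqdist _ _ mf2 mg2.
have p1 x : (0 <= (sqdist (f1 x) (g1 x))%:E)%E by rewrite lee_fin sqdist_ge0.
have p2 x : (0 <= (sqdist (f2 x) (g2 x))%:E)%E by rewrite lee_fin sqdist_ge0.
under eq_integral do rewrite 2!EFinD 2!EFinM.
rewrite ge0_integralD//.
- rewrite ge0_integralD//.
  + rewrite !ge0_integralZl_EFin//; congr (_ + _)%E.
    by rewrite (integral_cst w measurableT) -[RHS]mule1 -(probability_setT w).
  + by move=> x _; rewrite mule_ge0// lee_fin.
  + exact: measurable_funeM.
  + by move=> x _; rewrite mule_ge0// lee_fin.
  + exact: measurable_funeM.
- by move=> x _; rewrite adde_ge0// mule_ge0// lee_fin.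
- by apply: emeasurable_funD; exact: measurable_funeM.
Qed.

(** An almost-everywhere bound suffices, which is what a glued measure offers: its estimate holds
    only on the blocks. There [c] absorbs the size of a cube. *)
Lemma msqd_le_lin (a b c : R) f g f1 g1 f2 g2 :
  measurable_fun [set: X] f -> measurable_fun [set: X] g ->
  measurable_fun [set: X] f1 -> measurable_fun [set: X] g1 ->
  measurable_fun [set: X] f2 -> measurable_fun [set: X] g2 ->
  0 <= a -> 0 <= b -> 0 <= c ->
  {ae w, forall x, sqdist (f x) (g x) <=
     a * sqdist (f1 x) (g1 x) + b * sqdist (f2 x) (g2 x) + c} ->
  (msqd w f g <= a%:E * msqd w f1 g1 + b%:E * msqd w f2 g2 + c%:E)%E.
Proof.
move=> mf mg mf1 mg1 mf2 mg2 a0 b0 c0 H; rewrite -integral_sqdist_lin//.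
apply: ae_ge0_le_integral => //.
- by move=> x _; rewrite lee_fin sqdist_ge0.
- exact: measurable_sqdist.
- by move=> x _; rewrite lee_fin !addr_ge0// mulr_ge0// sqdist_ge0.
- under eq_fun do rewrite 2!EFinD 2!EFinM.
  apply: emeasurable_funD => //.
  by apply: emeasurable_funD; apply: measurable_funeM; exact: measurable_sqdist.
- by apply: filterS H => x xle _; rewrite lee_fin.
Qed.

End MeanSquare.

(** * Transitivity of being at finite distance *)

Section FiniteDistance.
Context {R : realType} {d : nat}.
Local Notation T := (Rd R d).

(** Unit cubes with integer corners, numbered through [pickle] because [gluing] takes sequences;
    numbers coding no corner give empty cells. *)
Definition cell (k : nat) : set T :=
  [set x | pickle (map_mx Num.floor (x : 'rV[R]_d) : 'rV[int]_d) = k].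

Lemma measurable_cell k : measurable (cell k).
Proof.
have [[z zk]|nz] := pselect (exists z : 'rV[int]_d, pickle z = k); last first.
  rewrite (_ : cell k = set0)//; apply/seteqP; split => // x xk.
  by apply: nz; eexists; exact: xk.
rewrite (_ : cell k = \bigcap_(j in [set: 'I_d])
    ((fun x : T => x ord0 j) @^-1` `[(z ord0 j)%:~R, (z ord0 j + 1)%:~R[)).
  apply: fin_bigcap_measurable => // j _.
  by rewrite -[X in measurable X]setTI; exact: measurable_coord.
apply/seteqP; split => x.
  rewrite /cell /= -zk => /(pcan_inj pickleK) <- j _ /=.
  by rewrite mxE in_itv /= ge_floor lt_succ_floor.
move=> H; rewrite /cell /= -zk; congr pickle; apply/rowP => j; rewrite mxE.
have := H j I; rewrite /= in_itv /= => /floor_def; exact.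
Qed.

Lemma trivIset_cell : trivIset setT cell.
Proof. by move=> i j _ _ [x [/= <- <-]]. Qed.

Lemma bigcup_cell : \bigcup_k cell k = setT.
Proof. by apply/seteqP; split => // x _; eexists => //. Qed.

Lemma sqdist_cell k (x y : T) : cell k x -> cell k y -> sqdist x y <= d%:R.
Proof.
rewrite /cell /= => <- /(pcan_inj pickleK) /rowP xy.
rewrite -[leRHS]mulr1 -[d in leRHS]card_ord -sumr_const mulr_suml ler_sum// => j _.
rewrite mul1r.
have := xy j; rewrite !mxE => xyj.
have := floor_itv (x ord0 j); have := floor_itv (y ord0 j).
rewrite xyj !intrD /=; move: ((Num.floor (x ord0 j))%:~R : R) => n.
move: (x ord0 j) (y ord0 j) => u v Hu Hv; nra.
Qed.

(** The path runs through [x], [y], [y'], [z]; the factor 3 is Cauchy-Schwarz for three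
    increments. *)
Lemma sqdist_triangle3 (x y y' z : T) :
  sqdist x z <= 3 * sqdist x y + 3 * sqdist y' z + 3 * sqdist y y'.
Proof.
rewrite /sqdist !mulr_sumr -!big_split /= ler_sum// => i _.
move: (x ord0 i) (y ord0 i) (y' ord0 i) (z ord0 i) => a b c e.
have -> : a - e = (a - b) + (b - c) + (c - e) by ring.
move: (a - b) (b - c) (c - e) => p q r.
have := sqr_ge0 (p - q); have := sqr_ge0 (q - r); have := sqr_ge0 (p - r).
nra.
Qed.

(** Two couplings of finite cost are glued along the cubes of their middle points. These points then
    share a cube almost surely, so the glued cost is at most three times the sum of the costs plus
    [3 * d]. *)
Lemma W2sq_lty_trans (a b c : probability T R) :
  (W2sq a b < +oo)%E -> (W2sq b c < +oo)%E -> (W2sq a c < +oo)%E.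
Proof.
move=> /ereal_inf_lt[_ [g1 [cg1 ->]] fin1] /ereal_inf_lt[_ [g2 [cg2 ->]] fin2].
(* Blocks: the second point of [g1] and the first point of [g2] lie in cube [k]; both events have
   mass [b (cell k)]. *)
have [||||||k|Q [Q1 Q2 Q0]] := @gluing R _ _ _ _ g1 g2
  (fun k => snd @^-1` cell k) (fun k => fst @^-1` cell k).
- by move=> k; rewrite -[X in measurable X]setTI; apply: measurable_snd => //; exact: measurable_cell.
- by move=> k; rewrite -[X in measurable X]setTI; apply: measurable_fst => //; exact: measurable_cell.
- by move=> i j _ _ [x xij]; apply: trivIset_cell => //; exists x.2.
- by move=> i j _ _ [x xij]; apply: trivIset_cell => //; exists x.1.
- by rewrite -preimage_bigcup bigcup_cell.
- by rewrite -preimage_bigcup bigcup_cell.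
- by have [_ ->] := cg1 _ (measurable_cell k); have [-> _] := cg2 _ (measurable_cell k).
have mx : measurable_fun setT (fun z : (T * T) * (T * T) => z.1.1).
  exact: measurableT_comp measurable_fst measurable_fst.
have my : measurable_fun setT (fun z : (T * T) * (T * T) => z.1.2).
  exact: measurableT_comp measurable_snd measurable_fst.
have my' : measurable_fun setT (fun z : (T * T) * (T * T) => z.2.1).
  exact: measurableT_comp measurable_fst measurable_snd.
have mz : measurable_fun setT (fun z : (T * T) * (T * T) => z.2.2).
  exact: measurableT_comp measurable_snd measurable_snd.
have mfst (A : set T) : measurable A -> measurable (fst @^-1` A : set (T * T)).
  by move=> mA; rewrite -[X in measurable X]setTI; exact: measurable_fst.
have msnd (A : set T) : measurable A -> measurable (snd @^-1` A : set (T * T)).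
  by move=> mA; rewrite -[X in measurable X]setTI; exact: measurable_snd.
apply: le_lt_trans (W2sq_le Q _ _ _ _ mx mz _ _) _.
- by move=> A mA; have [<- _] := cg1 _ mA; rewrite -Q1//; exact: mfst.
- by move=> A mA; have [_ <-] := cg2 _ mA; rewrite -Q2//; exact: msnd.
apply: le_lt_trans (@msqd_le_lin _ _ _ _ Q 3 3 (3 * d%:R) _ _ _ _ _ _ mx mz mx my my' mz _ _ _ _) _ => //.
- exists (~` \bigcup_k ((snd @^-1` cell k) `*` (fst @^-1` cell k))); split => //.
    apply: measurableC; apply: bigcupT_measurable => k; apply: measurableX.
    + exact: msnd (measurable_cell k).
    + exact: mfst (measurable_cell k).
  apply: subsetC => -[[x y] [y' z]] [k _ [/= yk y'k]].
  apply: le_trans (sqdist_triangle3 x y y' z) _.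
  by rewrite lerD2l ler_wpM2l//; exact: sqdist_cell yk y'k.
rewrite -(cost_marginal Q _ _ g1 mx my) -?(cost_marginal Q _ _ g2 my' mz)//; last 2 first.
- by move=> B mB; rewrite -Q2//; congr (Q _); apply/seteqP; split => -[? []].
- by move=> B mB; rewrite -Q1//; congr (Q _); apply/seteqP; split => -[[]].
by rewrite !lte_add_pinfty// ?ltry// lte_mul_pinfty.
Qed.

End FiniteDistance.

(** * Transport plans and generalized geodesics *)

Section TransportPlan.
Context {R : realType} {d : nat}.
Local Notation T := (Rd R d).
Local Notation X := ((T * T) * T)%type.

(** [leg1] is the base point of a plan, [leg2] and [leg3] its endpoints, and [leg23 a] traces the
    generalized geodesic. *)
Definition leg1 (z : X) : T := z.1.1.
Definition leg2 (z : X) : T := z.1.2.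
Definition leg3 (z : X) : T := z.2.
Definition leg23 (a : R) (z : X) : T :=
  ((1 - a) *: (z.1.2 : 'rV[R]_d) + a *: (z.2 : 'rV[R]_d))%R.

Lemma measurable_leg1 : measurable_fun setT leg1.
Proof. exact: measurableT_comp measurable_fst measurable_fst. Qed.

Lemma measurable_leg2 : measurable_fun setT leg2.
Proof. exact: measurableT_comp measurable_snd measurable_fst. Qed.

Lemma measurable_leg3 : measurable_fun setT leg3.
Proof. exact: measurable_snd. Qed.

Lemma measurable_leg23 a : measurable_fun setT (leg23 a).
Proof.
apply: measurable_fun_Rd => i; rewrite /leg23.
under eq_fun do rewrite !mxE.
apply: measurable_funD; apply: measurable_funM => //.
- exact: measurableT_comp (measurable_coord i) measurable_leg2.
- exact: measurableT_comp (measurable_coord i) measurable_leg3.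
Qed.

(** Seen from the base point, the squared distance is exactly quadratic along the segment. For
    [0 <= a <= 1] this form has only nonnegative terms, so it integrates in the extended reals. *)
Lemma sqdist_leg23 (a : R) (z : X) :
  sqdist (leg1 z) (leg23 a z) + a * (1 - a) * sqdist (leg2 z) (leg3 z) =
  (1 - a) * sqdist (leg1 z) (leg2 z) + a * sqdist (leg1 z) (leg3 z).
Proof.
rewrite /sqdist !mulr_sumr -!big_split /=; apply: eq_bigr => i _.
by rewrite /leg23 !mxE /leg1 /leg2 /leg3; ring.
Qed.

Lemma sqdist_leg2_leg23 (a : R) (z : X) :
  sqdist (leg2 z) (leg23 a z) = a ^+ 2 * sqdist (leg2 z) (leg3 z).
Proof.
rewrite /sqdist !mulr_sumr; apply: eq_bigr => i _.
by rewrite /leg23 !mxE /leg2 /leg3; ring.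
Qed.

(** Young's inequality: coordinatewise, the two sides differ by a multiple of a square. Being linear
    in the squared distances, it integrates term by term. *)
Lemma sqdist_weighted_triangle (e : R) (x y z : T) : 0 < e ->
  sqdist y z <= (1 + e) * sqdist x y + (1 + e^-1) * sqdist x z.
Proof.
move=> e0; rewrite /sqdist !mulr_sumr -!big_split /= ler_sum// => i _.
move: (x ord0 i) (y ord0 i) (z ord0 i) => p q r.
rewrite -subr_ge0 (_ : _ - _ = e^-1 * (e * (p - q) + (p - r)) ^+ 2).
  by rewrite mulr_ge0 ?invr_ge0 ?sqr_ge0// ltW.
by field; rewrite gt_eqF.
Qed.

Variables (om mu0 mu1 : probability T R) (w : probability X R).
Hypothesis plan : transport_plan om mu0 mu1 w.

Lemma W2sq_plan12 : W2sq om mu0 = msqd w leg1 leg2.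
Proof.
have [[g [[_ <-] gE]] _] := plan.
exact: cost_marginal measurable_leg1 measurable_leg2 gE.
Qed.

Lemma W2sq_plan13 : W2sq om mu1 = msqd w leg1 leg3.
Proof.
have [_ [g [[_ <-] gE]]] := plan.
exact: cost_marginal measurable_leg1 measurable_leg3 gE.
Qed.

Lemma plan_marginal1 A : measurable A -> om A = w (leg1 @^-1` A).
Proof.
have [[g [[cg _] gE]] _] := plan; move=> mA.
by have [<- _] := cg _ mA; rewrite gE// -[X in measurable X]setTI; exact: measurable_fst.
Qed.

Lemma plan_marginal2 A : measurable A -> mu0 A = w (leg2 @^-1` A).
Proof.
have [[g [[cg _] gE]] _] := plan; move=> mA.
by have [_ <-] := cg _ mA; rewrite gE// -[X in measurable X]setTI; exact: measurable_snd.
Qed.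

Lemma plan_marginal3 A : measurable A -> mu1 A = w (leg3 @^-1` A).
Proof.
have [_ [g [[cg _] gE]]] := plan; move=> mA.
by have [_ <-] := cg _ mA; rewrite gE// -[X in measurable X]setTI; exact: measurable_snd.
Qed.

Lemma W2sq_le_plan : (W2sq mu0 mu1 <= W2plan_sq w)%E.
Proof.
exact: W2sq_le w leg2 leg3 _ _ measurable_leg2 measurable_leg3
  plan_marginal2 plan_marginal3.
Qed.

Lemma plan_weighted_triangle (e : R) : 0 < e ->
  (W2plan_sq w <= (1 + e)%:E * W2sq om mu0 + (1 + e^-1)%:E * W2sq om mu1)%E.
Proof.
move=> e0; rewrite W2sq_plan12 W2sq_plan13 -[leRHS]adde0.
apply: (@msqd_le_lin _ _ _ _ w _ _ 0 leg2 leg3 leg1 leg2 leg1 leg3) => //.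
- exact: measurable_leg2.
- exact: measurable_leg3.
- exact: measurable_leg1.
- exact: measurable_leg2.
- exact: measurable_leg1.
- exact: measurable_leg3.
- by rewrite addr_ge0// ltW.
- by rewrite addr_ge0// invr_ge0 ltW.
- by apply: aeW => z; rewrite addr0; exact: sqdist_weighted_triangle.
Qed.

(** Integrating [sqdist_leg23] gives an equality under [w]; the inequality arises because [leg1] and
    [leg23 a] form a possibly non-optimal coupling of [om] and [mua]. *)
Lemma W2sq_gen_geod (a : R) (mua : probability T R) : 0 <= a <= 1 ->
  is_gen_geod_point w a mua ->
  (W2sq om mua + (a * (1 - a))%:E * W2plan_sq w <=
   (1 - a)%:E * W2sq om mu0 + a%:E * W2sq om mu1)%E.
Proof.
move=> /andP[a0 a1] muaE; have a1' : 0 <= 1 - a by rewrite subr_ge0.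
have m1 := measurable_leg1; have m2 := measurable_leg2.
have m3 := measurable_leg3; have m23 := measurable_leg23 a.
apply: (@le_trans _ _ (msqd w leg1 (leg23 a) + (a * (1 - a))%:E * W2plan_sq w)%E).
  by apply: leeD => //; exact: W2sq_le m1 m23 plan_marginal1 muaE.
rewrite W2sq_plan12 W2sq_plan13 -[leLHS]adde0 -[leRHS]adde0.
rewrite -[msqd _ _ (leg23 a)]mul1e -integral_sqdist_lin// ?mulr_ge0//.
rewrite -[leRHS]integral_sqdist_lin// le_eqVlt; apply/orP; left; apply/eqP.
by apply: eq_integral => z _; rewrite mul1r sqdist_leg23.
Qed.

(** Serves twice: it keeps geodesics at finite distance from [omega0], and it shows that they
    approach [mu0] as [a] tends to 0, where the slope can be used. *)
Lemma W2sq_gen_geod0 (a : R) (mua : probability T R) :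
  is_gen_geod_point w a mua ->
  (W2sq mu0 mua <= (a ^+ 2)%:E * W2plan_sq w)%E.
Proof.
move=> muaE.
have m2 := measurable_leg2; have m3 := measurable_leg3.
apply: le_trans (W2sq_le _ _ _ _ _ m2 (measurable_leg23 a) plan_marginal2 muaE) _.
rewrite /msqd /W2plan_sq -ge0_integralZl_EFin ?sqr_ge0//; last 2 first.
- by move=> z _; rewrite lee_fin sqdist_ge0.
- exact: measurable_sqdist m2 m3.
rewrite le_eqVlt; apply/orP; left; apply/eqP.
by apply: eq_integral => z _; rewrite sqdist_leg2_leg23.
Qed.

End TransportPlan.

(** Replaces each limit [e -> 0]; the restriction [e < 1] lets [e] be a geodesic parameter. *)
Lemma le_of_perturb {R : realFieldType} (x y c : R) :
  (forall e : R, 0 < e < 1 -> x <= y + e * c) -> x <= y.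
Proof.
move=> H; apply/ler_addgt0Pr => e e0.
have c1 : 0 < 1 + `|c| by rewrite ltr_pwDl.
have := H (Num.min (2^-1) (e / (1 + `|c|))).
set t := Num.min _ _; move=> Ht.
have t0 : 0 < t by rewrite lt_min invr_gt0 divr_gt0// ltr0n.
have t1 : t < 1 by rewrite gt_min invf_lt1// ltr1n.
have te : t * (1 + `|c|) <= e by rewrite -ler_pdivlMr// ge_min lexx orbT.
have := Ht; rewrite t0 t1 => /(_ isT) {}Ht.
have : t * c <= t * (1 + `|c|).
  by rewrite ler_pM2l// (le_trans (ler_norm c))// lerDr.
lra.
Qed.

(** * The discrete variational inequality and the slope *)

Section Functional.
Context {R : realType} {d : nat}.
Local Notation T := (Rd R d).
Variables (omega0 : probability T R) (E : probability T R -> \bar R) (lam : R).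
Local Notation P2 := (P2 omega0).
Local Notation ell := (lam_minus lam).
Hypotheses (E_fin : forall mu, P2 mu -> E mu != -oo%E)
  (E_lsc : lsc_W2 omega0 E) (E_convex : convex_gen_geod omega0 E lam).

Lemma lam_minus_ge0 : 0 <= ell.
Proof. by rewrite /lam_minus le_max lexx. Qed.

Lemma W2_ge0 (mu nu : probability T R) : 0 <= W2 mu nu.
Proof. exact: sqrtr_ge0. Qed.

Lemma W2C (mu nu : probability T R) : W2 mu nu = W2 nu mu.
Proof. by rewrite /W2 W2sqC. Qed.

Lemma W2xx (mu : probability T R) : W2 mu mu = 0.
Proof. by rewrite /W2 W2sqxx sqrtr0. Qed.

Lemma W2sq_fin_num (mu nu : probability T R) :
  P2 mu -> P2 nu -> W2sq mu nu \is a fin_num.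
Proof.
move=> Pmu Pnu; rewrite ge0_fin_numE ?W2sq_ge0//.
by apply: W2sq_lty_trans Pmu _; rewrite W2sqC.
Qed.

Lemma W2sqE (mu nu : probability T R) :
  P2 mu -> P2 nu -> W2sq mu nu = (W2 mu nu ^+ 2)%:E.
Proof.
move=> Pmu Pnu; rewrite /W2 sqr_sqrtr ?fine_ge0 ?W2sq_ge0// fineK//.
exact: W2sq_fin_num.
Qed.

(** The right-hand side is minimal at [e = B / A], with value [(A + B) ^+ 2]. Shifting [A] and [B]
    by [t > 0] covers the cases where one of them vanishes. *)
Lemma sqr_le_weighted (A B C : R) : 0 <= A -> 0 <= B ->
  (forall e, 0 < e -> C <= (1 + e) * A ^+ 2 + (1 + e^-1) * B ^+ 2) ->
  C <= (A + B) ^+ 2.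
Proof.
move=> A0 B0 H.
(* The constant comes from [(A + B + 2 * t) ^+ 2 = (A + B) ^+ 2 + 4 * t * (A + B) + 4 * t ^+ 2] and
   [t ^+ 2 <= t]. *)
apply: (@le_of_perturb _ _ _ (4 * (A + B) + 4)) => t /andP[t0 t1].
have at0 : 0 < A + t by lra.
have bt0 : 0 < B + t by lra.
have := H ((B + t) / (A + t)) (divr_gt0 bt0 at0).
rewrite invf_div => {}H.
have h1 : (1 + (B + t) / (A + t)) * A ^+ 2 <= (1 + (B + t) / (A + t)) * (A + t) ^+ 2.
  apply: ler_wpM2l; first by rewrite addr_ge0// ltW// divr_gt0.
  by nra.
have h2 : (1 + (A + t) / (B + t)) * B ^+ 2 <= (1 + (A + t) / (B + t)) * (B + t) ^+ 2.
  apply: ler_wpM2l; first by rewrite addr_ge0// ltW// divr_gt0.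
  by nra.
have e1 : (1 + (B + t) / (A + t)) * (A + t) ^+ 2 = (A + t + (B + t)) * (A + t).
  by field; rewrite gt_eqF.
have e2 : (1 + (A + t) / (B + t)) * (B + t) ^+ 2 = (A + t + (B + t)) * (B + t).
  by field; rewrite gt_eqF.
have : C <= (A + t + (B + t)) ^+ 2 by rewrite expr2; lra.
nra.
Qed.

(* [Wp] is the squared distance along the plan. *)
Lemma convex_gen_geod_real (mu0 mu1 om : probability T R) :
  P2 mu0 -> P2 mu1 -> P2 om ->
  exists Wp : R, [/\ 0 <= Wp, W2 mu0 mu1 ^+ 2 <= Wp,
    Wp <= (W2 om mu0 + W2 om mu1) ^+ 2 &
    E mu0 \is a fin_num -> E mu1 \is a fin_num ->
    forall a, 0 <= a <= 1 -> exists mua, [/\ P2 mua, E mua \is a fin_num,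
      fine (E mua) <= (1 - a) * fine (E mu0) + a * fine (E mu1)
                      + a * (1 - a) * ell / 2 * Wp,
      W2 om mua ^+ 2 <= (1 - a) * W2 om mu0 ^+ 2 + a * W2 om mu1 ^+ 2
                        - a * (1 - a) * Wp &
      W2 mu0 mua ^+ 2 <= a ^+ 2 * Wp]].
Proof.
move=> P0 P1 Pom; have [w [plan conv]] := E_convex mu0 mu1 om P0 P1 Pom.
have Wp0 : (0 <= W2plan_sq w)%E.
  by apply: integral_ge0 => z _; rewrite lee_fin sqdist_ge0.
have Wpfin : W2plan_sq w \is a fin_num.
  rewrite ge0_fin_numE//.
  apply: le_lt_trans (plan_weighted_triangle _ _ _ _ plan 1 ltr01) _.
  by rewrite !W2sqE// -!EFinM -EFinD ltry.
exists (fine (W2plan_sq w)); split.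
- exact: fine_ge0.
- by rewrite -lee_fin fineK// -W2sqE//; exact: W2sq_le_plan plan.
- apply: sqr_le_weighted; rewrite ?W2_ge0 ?fine_ge0// => e e0.
  have := plan_weighted_triangle _ _ _ _ plan e e0.
  by rewrite !W2sqE// -(fineK Wpfin) -!EFinM -EFinD lee_fin.
move=> E0 E1 a a01; have [mua [muaE Emua]] := conv a a01.
have H1 := W2sq_gen_geod _ _ _ _ plan a mua a01 muaE.
have H2 := W2sq_gen_geod0 _ _ _ _ plan a mua muaE.
(* [mua] is at finite distance from [mu0], hence from [omega0] by the crude gluing. *)
have Pmua : P2 mua.
  rewrite /Defs.P2 W2sqC.
  apply: (@W2sq_lty_trans _ _ _ mu0); first by rewrite W2sqC.
  by rewrite (le_lt_trans H2)// -(fineK Wpfin) -EFinM ltry.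
move: Emua; rewrite -(fineK E0) -(fineK E1) -(fineK Wpfin) -!EFinM -!EFinN -!EFinD => Emua.
have fmua : E mua \is a fin_num.
  by rewrite fin_real// (le_lt_trans Emua) ?ltry// ltNye E_fin.
exists mua; split => //.
- move: Emua; rewrite -(fineK fmua) lee_fin => /le_trans; apply.
  rewrite lerD2l -mulNr ler_wpM2r ?fine_ge0//.
  have a1 : 0 <= a * (1 - a) by rewrite mulr_ge0//; lra.
  have : - lam <= ell by rewrite le_max lexx orbT.
  by nra.
- by move: H1; rewrite !W2sqE// -(fineK Wpfin) -!EFinM -!EFinD lee_fin; lra.
- by move: H2; rewrite !W2sqE// -(fineK Wpfin) -!EFinM lee_fin.
Qed.

(* The plan given by convexity glues optimal couplings of [om] with [mu0], [mu1]. *)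
Lemma W2_triangle (mu0 mu1 om : probability T R) :
  P2 mu0 -> P2 mu1 -> P2 om -> W2 mu0 mu1 <= W2 om mu0 + W2 om mu1.
Proof.
move=> P0 P1 Pom; have [Wp [_ H1 H2 _]] := convex_gen_geod_real _ _ _ P0 P1 Pom.
rewrite -ler_sqr ?nnegrE ?addr_ge0 ?W2_ge0//; exact: le_trans H1 H2.
Qed.

(** * A single minimizing step *)

Section Step.
Variables (tau : R) (mu J : probability T R).
Hypotheses (tau0 : 0 < tau) (ltau : ell * tau < 1).
Hypotheses (Pmu : P2 mu) (fEmu : E mu \is a fin_num).
Hypothesis JKO : is_JKO_step omega0 E tau mu J.

Lemma JKO_P2 : P2 J.
Proof. by have [] := JKO. Qed.

(** Minimality tested against [mu] itself bounds [E J] from above. *)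
Lemma JKO_fin_num : E J \is a fin_num.
Proof.
have [PJ /(_ mu Pmu)] := JKO.
rewrite W2sqxx mule0 add0e W2sqE// -EFinM => H.
rewrite fin_real// ltNye E_fin//= ltey; apply/eqP => EJ.
by move: H; rewrite EJ addey// leye_eq => /eqP Emu; move: fEmu; rewrite Emu.
Qed.

Lemma JKO_min (v : probability T R) : P2 v -> E v \is a fin_num ->
  (2 * tau)^-1 * W2 mu J ^+ 2 + fine (E J) <=
  (2 * tau)^-1 * W2 mu v ^+ 2 + fine (E v).
Proof.
move=> Pv fv; have [PJ /(_ v Pv)] := JKO; have fJ := JKO_fin_num.
by rewrite !W2sqE// -(fineK fv) -(fineK fJ) -!EFinM -!EFinD lee_fin.
Qed.

(** The competitor is the point at parameter [a] of the geodesic from [J] to [v] with base [mu]; the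
    inequality follows on dividing by [a] and letting [a] tend to 0. *)
Lemma discrete_EVI (v : probability T R) : P2 v -> E v \is a fin_num ->
  (1 - ell * tau) * W2 J v ^+ 2 - W2 mu v ^+ 2 <=
  2 * tau * (fine (E v) - fine (E J)) - W2 mu J ^+ 2.
Proof.
move=> Pv fv; have PJ := JKO_P2; have fJ := JKO_fin_num.
have [Wp [Wp0 WpJv _ /(_ fJ fv) H]] := convex_gen_geod_real _ _ _ PJ Pv Pmu.
(* Both convexity estimates involve the plan length, so the inequality is proved for [Wp], which
   dominates [W2 J v ^+ 2] and has a nonnegative coefficient. *)
suff : (1 - ell * tau) * Wp - W2 mu v ^+ 2 <=
    2 * tau * (fine (E v) - fine (E J)) - W2 mu J ^+ 2.
  by apply: le_trans; rewrite lerD2r ler_wpM2l// subr_ge0 ltW.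
(* Division by [a] leaves a factor [1 - a] on this term; its [a] part is the error. *)
apply: (@le_of_perturb _ _ _ ((1 - ell * tau) * Wp)) => a /andP[a0 a1].
have [|mua [Pmua fmua Emua Wmua _]] := H a; first by rewrite !ltW.
have := JKO_min _ Pmua fmua.
set c := (2 * tau)^-1 => Hmin.
have c0 : 0 < c by rewrite invr_gt0 mulr_gt0.
have ct : 2 * tau * c = 1 by rewrite mulfV// gt_eqF// mulr_gt0.
move: Hmin Emua Wmua.
move: (fine (E mua)) (fine (E J)) (fine (E v)) (W2 mu mua ^+ 2)
  (W2 mu J ^+ 2) (W2 mu v ^+ 2) => Ea EJ Ev wa wJ wv Hmin Emua Wmua.
have Hmin' : wJ + 2 * tau * EJ <= wa + 2 * tau * Ea.
  have -> : wJ = 2 * tau * (c * wJ) by rewrite mulrA ct mul1r.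
  have -> : wa = 2 * tau * (c * wa) by rewrite mulrA ct mul1r.
  by rewrite -!mulrDr ler_pM2l// mulr_gt0.
have Emua' : 2 * tau * Ea <= 2 * tau * ((1 - a) * EJ + a * Ev
                      + a * (1 - a) * ell / 2 * Wp).
  by rewrite ler_pM2l// mulr_gt0.
rewrite -(ler_pM2l a0).
have -> : a * ((1 - ell * tau) * Wp - wv) = a * (1 - ell * tau) * Wp - a * wv by ring.
have -> : a * (2 * tau * (Ev - EJ) - wJ + a * ((1 - ell * tau) * Wp)) =
  2 * tau * ((1 - a) * EJ + a * Ev + a * (1 - a) * ell / 2 * Wp)
  + ((1 - a) * wJ + a * wv - a * (1 - a) * Wp) - (wJ + 2 * tau * EJ)
  + (a * (1 - ell * tau) * Wp - a * wv) by field.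
by rewrite lerDr; lra.
Qed.

(* [lam]-convexity upgrades the local condition [slope nu <= s] to this. *)
Definition slope_bound (nu : probability T R) (s : R) :=
  forall v, P2 v -> E v \is a fin_num ->
    fine (E nu) - fine (E v) <= s * W2 nu v + ell / 2 * W2 nu v ^+ 2.

(** The variational inequality at [v = mu] meets the slope bound at [v = J]; one factor [W2 mu J] is
    then divided out. *)
Lemma JKO_dist (s : R) : 0 <= s -> slope_bound mu s ->
  W2 mu J <= tau * s / (1 - ell * tau).
Proof.
move=> s0 /(_ J JKO_P2 JKO_fin_num) H1.
have := discrete_EVI mu Pmu fEmu; rewrite W2xx (W2C J mu) expr0n /= => H2.
have l1 : 0 < 1 - ell * tau by rewrite subr_gt0.
rewrite ler_pdivlMr//.
have := W2_ge0 mu J; rewrite le_eqVlt => /orP[/eqP<-|W0].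
  by rewrite mul0r mulr_ge0// ltW.
rewrite -(ler_pM2r W0).
have : 2 * tau * (fine (E mu) - fine (E J)) <=
  2 * tau * (s * W2 mu J + ell / 2 * W2 mu J ^+ 2) by rewrite ler_pM2l// mulr_gt0.
nra.
Qed.

(** Expanding [(W2 mu J + W2 J v) ^+ 2] in the variational inequality cancels [W2 mu J ^+ 2] and
    leaves the cross term as the slope term. *)
Lemma JKO_slope_bound : slope_bound J (W2 mu J / tau).
Proof.
move=> v Pv fv; have PJ := JKO_P2.
have H := discrete_EVI v Pv fv.
have := W2_triangle _ _ _ Pmu Pv PJ; rewrite (W2C J mu) => tri.
have W1 := W2_ge0 mu J; have W2' := W2_ge0 J v; have W3 := W2_ge0 mu v.
have t20 : 0 < 2 * tau by rewrite mulr_gt0.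
have sq : W2 mu v ^+ 2 <= (W2 mu J + W2 J v) ^+ 2 by rewrite ler_sqr ?nnegrE ?addr_ge0.
rewrite -(ler_pM2l t20).
have -> : 2 * tau * (W2 mu J / tau * W2 J v + ell / 2 * W2 J v ^+ 2) =
   2 * W2 mu J * W2 J v + ell * tau * W2 J v ^+ 2 by field; rewrite gt_eqF.
by move: H sq; rewrite !mulrBr; nra.
Qed.

End Step.

(* At an isolated [mu] the slope is [-oo], whose [fine] is [0]. *)
Lemma slope_bound_of_slope (mu : probability T R) :
  in_dom_slope omega0 E mu -> slope_bound mu `|fine (slope omega0 E mu)|.
Proof.
move=> [Pmu [Emu slmu]] v Pv fv.
have fmu : E mu \is a fin_num by rewrite fin_real// ltNye E_fin.
set s := `|_|.
(* Taking the base at the starting point [mu] bounds the plan length by [W2 mu v ^+ 2]. *)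
have [Wp [Wp0 _ WpU /(_ fmu fv) H]] := convex_gen_geod_real _ _ _ Pmu Pv Pmu.
rewrite W2xx add0r in WpU.
have W0 := W2_ge0 mu v.
apply: (@le_of_perturb _ _ _ (W2 mu v)) => t /andP[t0 t1].
have : (slope omega0 E mu < (s + t)%:E)%E.
  apply: (@le_lt_trans _ _ s%:E); last by rewrite lte_fin ltrDl.
  rewrite /s; case: (slope omega0 E mu) slmu => [x _|//|_]; last exact: leNye.
  by rewrite lee_fin ler_norm.
move=> /ereal_inf_lt[_ [r /= r0 <-] supr].
have s0 : 0 <= s by exact: normr_ge0.
have near nu : P2 nu -> E nu \is a fin_num -> W2 mu nu < r ->
    fine (E mu) - fine (E nu) <= (s + t) * W2 mu nu.
  move=> Pnu fnu nur; have := W2_ge0 mu nu; rewrite le_eqVlt => /orP[/eqP nu0|nu0].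
    (* The slope ignores points at distance 0; lower semicontinuity handles them. *)
    rewrite -nu0 mulr0 subr_le0 leNgt; apply/negP => lt.
    have [|q [q0 /(_ nu Pnu)]] := E_lsc mu Pmu (fine (E nu)).
      by rewrite -(fineK fmu) lte_fin.
    by rewrite -nu0 => /(_ q0); rewrite fineK// ltxx.
  rewrite -ler_pdivrMr// -lee_fin.
  apply: le_trans _ (ltW supr).
  apply: le_trans _ (ereal_sup_ubound _); last first.
    by exists nu => //.
  rewrite EFinM lee_pmul2r ?lte_fin ?invr_gt0// EFinD EFinN !fineK//.
  by rewrite le_max lexx.
(* Small enough that [mua] falls within radius [r]; the [+ 1] guards against [W2 mu v = 0]. *)
pose a := Num.min 2^-1 (r / (2 * (W2 mu v + 1))).
have W1 : 0 < 2 * (W2 mu v + 1) by lra.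
have a0 : 0 < a by rewrite lt_min invr_gt0 ltr0n /= divr_gt0.
have a1 : a < 1 by rewrite gt_min invf_lt1// ltr1n.
have aW : a * W2 mu v < r.
  have : a * (2 * (W2 mu v + 1)) <= r by rewrite -ler_pdivlMr// ge_min lexx orbT.
  nra.
have [|mua [Pmua fmua Emua _ Wmua]] := H a; first by rewrite !ltW.
have Wa : W2 mu mua <= a * W2 mu v.
  rewrite -ler_sqr ?nnegrE ?W2_ge0 ?mulr_ge0 ?(ltW a0)// exprMn.
  by apply: le_trans Wmua _; rewrite ler_pM2l// exprn_gt0.
have Nmua := near mua Pmua fmua (le_lt_trans Wa aW).
have : (s + t) * W2 mu mua <= (s + t) * (a * W2 mu v).
  by rewrite ler_wpM2l// addr_ge0// ltW.
have l0 := lam_minus_ge0.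
have : a * (1 - a) * ell / 2 * Wp <= a * (ell / 2 * W2 mu v ^+ 2).
  rewrite (_ : a * (1 - a) * ell / 2 * Wp = a * (ell / 2) * ((1 - a) * Wp)); last ring.
  rewrite [leRHS]mulrA ler_wpM2l ?mulr_ge0 ?invr_ge0 ?(ltW a0)//.
  by apply: le_trans WpU; rewrite ler_piMl// lerBlDr lerDl ltW.
move=> K1 Z1; rewrite -(ler_pM2l a0); move: Nmua Emua K1 Z1.
move: (fine (E mua)) (fine (E mu)) (fine (E v)) ((s + t) * W2 mu mua).
move: (a * (1 - a) * ell / 2 * Wp) => K Ea Em Ev Z N1 E1 K1 Z1.
by nra.
Qed.

End Functional.

(** * Comparison of the two sequences *)

(** Real arguments allow the shifts of [N] by 1 and of [S] by [h]. *)
Definition rate_bound {R : realFieldType} (tau N S : R) : R :=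
  (N * tau - S) ^+ 2 + tau * S + 2 * tau ^+ 2 * N.

(** For [l = 0] the weights [tau] and [h] cancel the terms linear in [N * tau - S], and the
    increments of [tau * S] and [2 * tau ^+ 2 * N] pay for the squares left over. For [l > 0] the
    difference of the sides is still an explicit sum of nonnegative terms. *)
Lemma rate_bound_rec {R : realFieldType} (l tau h N S : R) :
  0 <= l -> 0 < h <= tau -> l * tau < 1 -> 1 <= N -> h <= S ->
  tau * (1 - l * h) ^+ 2 * rate_bound tau N (S - h) +
  h * (1 - l * tau) ^+ 2 * rate_bound tau (N - 1) S <=
  (tau * (1 - l * h) + h * (1 - l * tau)) * rate_bound tau N S.
Proof.
move=> l0 /andP[h0 ht] lt1 N1 hS.
have t0 : 0 < tau by lra.
have lh1 : l * h < 1 by apply: le_lt_trans lt1; rewrite ler_wpM2l.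
rewrite -subr_ge0 /rate_bound.
rewrite (_ : _ - _ = tau * h *
   (l * ((1 - l * h) + (1 - l * tau)) *
     ((N * tau - S - (tau - h)) ^+ 2 +
       (tau * S + 2 * tau ^+ 2 * (N - 1)) + (2 * tau ^+ 2 - (tau - h) ^+ 2))
    + (1 - l * h) ^+ 2 * (tau - h) + (1 - l * tau) ^+ 2 * tau)); last ring.
have p1 : 0 <= 2 * tau ^+ 2 - (tau - h) ^+ 2 by nra.
have p2 : 0 <= tau * S + 2 * tau ^+ 2 * (N - 1).
  by apply: addr_ge0; [|apply: mulr_ge0]; nra.
have p3 : 0 <= l * ((1 - l * h) + (1 - l * tau)) by rewrite mulr_ge0//; lra.
apply: mulr_ge0; first by rewrite mulr_ge0// ltW.
apply: addr_ge0; last by rewrite mulr_ge0 ?sqr_ge0// ltW.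
apply: addr_ge0; last by rewrite mulr_ge0 ?sqr_ge0 ?subr_ge0.
apply: mulr_ge0 => //; apply: addr_ge0 => //; apply: addr_ge0 => //.
exact: sqr_ge0.
Qed.

Section Main.
Context {R : realType} {d : nat}.
Local Notation T := (Rd R d).
Variables (omega0 : probability T R) (E : probability T R -> \bar R) (lam : R).
Local Notation P2 := (P2 omega0).
Local Notation ell := (lam_minus lam).
Hypotheses (E_fin : forall mu, P2 mu -> E mu != -oo%E)
  (E_lsc : lsc_W2 omega0 E) (E_convex : convex_gen_geod omega0 E lam).
Variable mu : probability T R.
Hypothesis Hmu : in_dom_slope omega0 E mu.
Local Notation s := `|fine (slope omega0 E mu)|.

(** * Slope and distance growth along one sequence of steps *)

Section Iterates.
Variables (h : nat -> R) (J : nat -> probability T R).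
Hypothesis h_gt0 : forall k, 0 < h k.+1.
Hypothesis h_lt : forall k, ell * h k.+1 < 1.
Hypothesis J0 : J 0%N = mu.
Hypothesis JS : forall m, is_JKO_step omega0 E (h m.+1) (J m) (J m.+1).

Lemma iterate_P2 m : P2 (J m).
Proof. by case: m => [|m]; [rewrite J0; case: Hmu|have [] := JS m]. Qed.

Lemma iterate_fin_num m : E (J m) \is a fin_num.
Proof.
elim: m => [|m IH].
  rewrite J0; have [Pmu [Emu _]] := Hmu.
  by rewrite fin_real// ltNye E_fin.
exact: JKO_fin_num E_fin _ _ _ (iterate_P2 m) IH (JS m).
Qed.

Local Notation S m := (\sum_(1 <= k < m.+1) h k).
Local Notation P m := (\prod_(1 <= k < m.+1) (1 - ell * h k)^-1).

Lemma steps_sumS m : S m.+1 = S m + h m.+1.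
Proof. by rewrite big_nat_recr. Qed.

Lemma steps_prodS m : P m = (1 - ell * h m.+1) * P m.+1.
Proof.
by rewrite [in RHS]big_nat_recr//= mulrCA mulfV ?mulr1// subr_eq0 gt_eqF.
Qed.

Lemma steps_sum_ge0 m : 0 <= S m.
Proof.
elim: m => [|m IH]; first by rewrite big_geq.
by rewrite steps_sumS addr_ge0// ltW.
Qed.

Lemma steps_prod_ge0 m : 0 <= P m.
Proof.
rewrite big_nat; apply: prodr_ge0 => -[//|k] _.
by rewrite invr_ge0 subr_ge0 ltW.
Qed.

Lemma steps_prod_le m : P m <= P m.+1.
Proof.
rewrite steps_prodS ler_piMl ?steps_prod_ge0// lerBlDr lerDl mulr_ge0//.
  exact: lam_minus_ge0.
exact: ltW.
Qed.

(** Conditional on the slope bound at [m], so that the induction for [iterate_slope_bound] can call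
    it. *)
Lemma iterate_step_dist m :
  slope_bound omega0 E lam (J m) (s * P m) ->
  W2 (J m) (J m.+1) <= h m.+1 * (s * P m.+1).
Proof.
move=> H; have := JKO_dist _ _ _ E_fin E_convex _ _ _ (h_gt0 m) (h_lt m) (iterate_P2 m)
  (iterate_fin_num m) (JS m) _ (mulr_ge0 (normr_ge0 _) (steps_prod_ge0 m)) H.
rewrite ler_pdivlMr ?subr_gt0// steps_prodS.
rewrite (_ : h m.+1 * _ = h m.+1 * (s * P m.+1) * (1 - ell * h m.+1)); last by ring.
by rewrite ler_pM2r ?subr_gt0.
Qed.

(** The slope at the new point is at most displacement over step size, and the displacement is at
    most [h m.+1 * (s * P m.+1)]. *)
Lemma iterate_slope_bound m : slope_bound omega0 E lam (J m) (s * P m).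
Proof.
elim: m => [|m IH].
  rewrite big_geq// mulr1 J0; exact: slope_bound_of_slope.
move=> v Pv fv.
apply: le_trans (JKO_slope_bound _ _ _ E_fin E_convex _ _ _ (h_gt0 m) (h_lt m) (iterate_P2 m)
  (iterate_fin_num m) (JS m) v Pv fv) _.
rewrite lerD2r ler_wpM2r ?W2_ge0// ler_pdivrMr// mulrC.
exact: iterate_step_dist.
Qed.

(** Displacements add up, each earlier factor [P k] being at most the last one. *)
Lemma iterate_dist m : W2 mu (J m) <= S m * P m * s.
Proof.
elim: m => [|m IH]; first by rewrite J0 W2xx !big_geq// !mul0r.
have Pmu : P2 mu by case: Hmu.
have := W2_triangle _ _ _ E_fin E_convex _ _ _ Pmu (iterate_P2 m.+1) (iterate_P2 m).
rewrite (W2C (J m) mu) => /le_trans; apply.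
have := iterate_step_dist m (iterate_slope_bound m).
have : S m * P m * s <= S m * P m.+1 * s.
  by rewrite ler_wpM2r// ler_wpM2l ?steps_sum_ge0// steps_prod_le.
rewrite steps_sumS; move: IH.
move: (P m.+1) (S m * P m * s) (S m) => p q r; nra.
Qed.

End Iterates.

(** * Double induction on the two step counts *)

Section TwoSequences.
Variables (tau : R) (h : nat -> R).
Hypothesis Hh : forall i : nat, (0 < i)%N -> 0 < h i <= tau.
Hypothesis Htau : ell * tau < 1.
Variables (Jh Jt : nat -> probability T R).
Hypothesis Jh0 : Jh 0%N = mu.
Hypothesis JhS : forall m : nat, is_JKO_step omega0 E (h m.+1) (Jh m) (Jh m.+1).
Hypothesis Jt0 : Jt 0%N = mu.
Hypothesis JtS : forall n : nat, is_JKO_step omega0 E tau (Jt n) (Jt n.+1).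

Local Notation S m := (\sum_(1 <= k < m.+1) h k).
Local Notation P m := (\prod_(1 <= k < m.+1) (1 - ell * h k)^-1).

Let h_gt0 k : 0 < h k.+1.
Proof. by have /andP[] := Hh k.+1 isT. Qed.

Let h_le k : h k.+1 <= tau.
Proof. by have /andP[] := Hh k.+1 isT. Qed.

Let tau_gt0 : 0 < tau.
Proof. exact: lt_le_trans (h_gt0 0) (h_le 0). Qed.

Let h_lt k : ell * h k.+1 < 1.
Proof. by apply: le_lt_trans Htau; rewrite ler_wpM2l// lam_minus_ge0. Qed.

Lemma JKO_dist_rec n m :
  (tau * (1 - ell * h m.+1) + h m.+1 * (1 - ell * tau)) *
    W2 (Jt n.+1) (Jh m.+1) ^+ 2 <=
  tau * W2 (Jt n.+1) (Jh m) ^+ 2 + h m.+1 * W2 (Jt n) (Jh m.+1) ^+ 2.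
Proof.
have Ph := iterate_P2 h Jh Jh0 JhS; have Pt := iterate_P2 (fun=> tau) Jt Jt0 JtS.
have fh := iterate_fin_num h Jh Jh0 JhS.
have ft := iterate_fin_num (fun=> tau) Jt Jt0 JtS.
have H1 := discrete_EVI _ _ _ E_fin E_convex _ _ _ (h_gt0 m) (h_lt m) (Ph m) (fh m) (JhS m)
  _ (Pt n.+1) (ft n.+1).
have H2 := discrete_EVI _ _ _ E_fin E_convex _ _ _ tau_gt0 Htau (Pt n) (ft n) (JtS n)
  _ (Ph m.+1) (fh m.+1).
(* With weights [tau] and [h m.+1] both energy differences get the factor [2 * tau * h m.+1] and
   cancel; the one-step distances are dropped by sign. *)
have {}H1 := ler_wpM2l (ltW tau_gt0) H1.
have {}H2 := ler_wpM2l (ltW (h_gt0 m)) H2.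
have q1 : 0 <= tau * W2 (Jh m) (Jh m.+1) ^+ 2 by rewrite mulr_ge0 ?sqr_ge0// ltW.
have q2 : 0 <= h m.+1 * W2 (Jt n) (Jt n.+1) ^+ 2.
  by rewrite mulr_ge0 ?sqr_ge0// ltW.
move: H1 H2 q1 q2; rewrite (W2C (Jh m.+1)) (W2C (Jh m)).
lra.
Qed.

Lemma JKO_rate n m :
  W2 (Jt n) (Jh m) ^+ 2 <=
  rate_bound tau n%:R (S m) * ((1 - ell * tau) ^- n * P m * s) ^+ 2.
Proof.
have B0 : 0 < 1 - ell * tau by rewrite subr_gt0.
have PE k : \prod_(1 <= i < k.+1) (1 - ell * tau)^-1 = (1 - ell * tau) ^- k.
  by rewrite big_const_nat subSS subn0 iter_mulr_1 exprVn.
have SE k : \sum_(1 <= i < k.+1) tau = k%:R * tau.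
  by rewrite big_const_nat subSS subn0 iter_addr_0 mulr_natl.
have distt := iterate_dist (fun=> tau) Jt (fun=> tau_gt0) (fun=> Htau) Jt0 JtS.
have disth := iterate_dist h Jh h_gt0 h_lt Jh0 JhS.
(* Outer induction for all [m] at once, inner one on [m]. On the axes the bound is [iterate_dist]
   squared, the linear terms of [rate_bound] being nonnegative. *)
elim: n m => [|n IHn] m.
  rewrite Jt0 expr0 invr1 mul1r; have := disth m; rewrite -ler_sqr ?nnegrE ?W2_ge0//; last first.
    by rewrite !mulr_ge0 ?steps_sum_ge0 ?steps_prod_ge0.
  move=> /le_trans; apply; rewrite -mulrA exprMn ler_wpM2r ?sqr_ge0//.
  rewrite /rate_bound mul0r sub0r sqrrN mulr0 addr0 lerDl mulr_ge0 ?(ltW tau_gt0)//.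
  exact: steps_sum_ge0.
elim: m => [|m IHm].
  rewrite Jh0 [X in _ * X * s]big_geq// mulr1 W2C.
  have := distt n.+1; rewrite PE SE -ler_sqr ?nnegrE ?W2_ge0//; last first.
    by rewrite !mulr_ge0 ?invr_ge0 ?exprn_ge0 ?(ltW tau_gt0) ?(ltW B0).
  move=> /le_trans; apply; rewrite -mulrA exprMn ler_wpM2r ?sqr_ge0//.
  rewrite /rate_bound big_geq// subr0 mulr0 addr0 lerDl.
  by rewrite !mulr_ge0 ?(ltW tau_gt0).
have h0 := h_gt0 m.
have A0 : 0 < 1 - ell * h m.+1 by rewrite subr_gt0.
have c0 : 0 < tau * (1 - ell * h m.+1) + h m.+1 * (1 - ell * tau).
  by rewrite addr_gt0// mulr_gt0.
rewrite -(ler_pM2l c0); apply: le_trans (JKO_dist_rec n m) _.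
have {}IHm := ler_wpM2l (ltW tau_gt0) IHm.
have {IHn} IHn' := ler_wpM2l (ltW h0) (IHn m.+1).
apply: le_trans (lerD IHm IHn') _.
(* Both hypotheses are rewritten with the factors of the target index; the factors released,
   squared, are the weights in [rate_bound_rec]. *)
have QE : (1 - ell * tau) ^- n = (1 - ell * tau) * (1 - ell * tau) ^- n.+1.
  by rewrite exprS invfM mulrA mulfV ?mul1r// gt_eqF.
have := @rate_bound_rec _ ell tau (h m.+1) n.+1%:R (S m.+1)
  (lam_minus_ge0 lam) (Hh m.+1 isT) Htau _ _.
have nE : n.+1%:R - 1 = n%:R :> R by rewrite -natr1 addrK.
rewrite QE (steps_prodS h h_lt m) nE.
rewrite (steps_sumS h m) addrK ler1n lerDr steps_sum_ge0// => /(_ isT isT) H.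
set K := ((1 - ell * tau) ^- n.+1 * P m.+1 * s) ^+ 2.
have K0 : 0 <= K by exact: sqr_ge0.
rewrite [leRHS]mulrA; apply: le_trans _ (ler_wpM2r K0 H).
by rewrite le_eqVlt; apply/orP; left; apply/eqP; rewrite /K; ring.
Qed.

End TwoSequences.
End Main.

Theorem theoremA3 (R : realType) (d : nat) (omega0 : probability (Rd R d) R)
  (E : probability (Rd R d) R -> \bar R) (lam : R)
  (E_fin : forall mu, P2 omega0 mu -> E mu != -oo%E)
  (E_proper : proper_fun omega0 E)
  (E_coercive : coercive omega0 E)
  (E_lsc : lsc_W2 omega0 E)
  (E_convex : convex_gen_geod omega0 E lam)
  (mu : probability (Rd R d) R) (Hmu : in_dom_slope omega0 E mu)
  (tau : R) (h : nat -> R)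
  (Hh : forall i : nat, (0 < i)%N -> 0 < h i <= tau)
  (Htau : lam_minus lam * tau < 1)
  (Jh Jt : nat -> probability (Rd R d) R)
  (Jh0 : Jh 0%N = mu)
  (JhS : forall m : nat, is_JKO_step omega0 E (h m.+1) (Jh m) (Jh m.+1))
  (Jt0 : Jt 0%N = mu)
  (JtS : forall n : nat, is_JKO_step omega0 E tau (Jt n) (Jt n.+1)) :
  forall n m : nat,
    let S := \sum_(1 <= k < m.+1) h k in
    let P := \prod_(1 <= k < m.+1) (1 - lam_minus lam * h k)^-1 in
    W2 (Jt n) (Jh m) ^+ 2 <=
      ((n%:R * tau - S) ^+ 2 + tau * S + 2 * tau ^+ 2 * n%:R)
      * (1 - lam_minus lam * tau) ^- (2 * n) * P ^+ 2
      * fine (slope omega0 E mu) ^+ 2.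
Proof.
move=> n m; cbv zeta.
apply: le_trans (JKO_rate _ _ _ E_fin E_lsc E_convex mu Hmu tau h Hh Htau Jh Jt
  Jh0 JhS Jt0 JtS n m) _.
rewrite /rate_bound !exprMn real_normK ?num_real// exprVn -exprM (mulnC n).
by rewrite le_eqVlt; apply/orP; left; apply/eqP; ring.
Qed.
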